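(* Let $a\geq1$ and $k\geq0$ be integers, let $V$ be a finite totally ordered set with $|V|=a+k$, and let $A=(a_{ij})_{i,j\in V}$ be a real matrix with $A\in\operatorname{TP}_{k+1}(V)$. Then for every $v\in V$, $$\Psi_v^{a,k}(A)\geq0.$$
   Context: $\mathfrak{S}(V)$ is the symmetric group on $V$. For $\sigma\in\mathfrak{S}(V)$ and $v\in V$, $\ell_v(\sigma)$ is the length of the cycle of $\sigma$ containing $v$ (a fixed point being a $1$-cycle), and $\operatorname{wt}_A(\sigma)=\prod_{i\in V}a_{i\sigma(i)}$. For $|V|=a+k$, $a\ge1$, $k\ge0$, $v\in V$, the cycle sum with marked vertex $v$ is $$\Psi_v^{a,k}(A)=(-1)^{a-1}\sum_{\substack{\sigma\in\mathfrak{S}(V)\\ \ell_v(\sigma)\ge a}}\operatorname{sgn}(\sigma)\operatorname{wt}_A(\sigma).$$ For $r\ge1$, $\operatorname{TP}_r(V)$ is the set of real matrices $A$ indexed by $V$ such that $\det A(I\mid J)\ge0$ for all $I,J\subseteq V$ with $|I|=|J|\le r$, where $A(I\mid J)$ is the submatrix with rows $I$ and columns $J$, both in increasing order (if $r>|V|$, only existing minors are considered). *)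

(* Defs.v *)
From mathcomp Require Import all_boot all_order all_algebra all_fingroup.
From mathcomp Require Import reals.

Set Implicit Arguments.
Unset Strict Implicit.
Unset Printing Implicit Defensive.

Import Order.TTheory GRing.Theory Num.Theory.
Local Open Scope ring_scope.

(* Matrices indexed by V are functions V -> V -> R. *)

Definition wt (R : comPzRingType) (V : finType) (A : V -> V -> R)
    (s : {perm V}) : R :=
  \prod_(i : V) A i (s i).

(* The size of [porbit s v] is 1 when v is a fixed point of s. *)
Definition cycle_length (V : finType) (s : {perm V}) (v : V) : nat :=
  #|porbit s v|.

(* Psi_v^{a,k}(A); the parameter k is determined by #|V| = a + k.
   In [(-1) ^+ s], the permutation s is coerced to its parity [odd_perm s]. *)
Definition cycle_sum (R : comPzRingType) (V : finType) (a : nat)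
    (A : V -> V -> R) (v : V) : R :=
  (-1) ^+ a.-1 *
    \sum_(s : {perm V} | (a <= cycle_length s v)%N) (-1) ^+ s * wt A s.

(* [Order.enum_val] lists the elements of a set in increasing order, unlike
   [enum_val], which follows the enumeration of the underlying finType. *)
Definition submatrix (R : Type) (d : Order.disp_t) (V : finOrderType d)
    (A : V -> V -> R) (I J : {set V}) : 'M[R]_(#|I|, #|J|) :=
  \matrix_(i < #|I|, j < #|J|) A (Order.enum_val i) (Order.enum_val j).

(* The cast makes the submatrix A(I|J) square. *)
Definition minor (R : comPzRingType) (d : Order.disp_t) (V : finOrderType d)
    (A : V -> V -> R) (I J : {set V}) (eqJI : #|J| = #|I|) : R :=
  \det (castmx (erefl #|I|, eqJI) (submatrix A I J)).

Definition TP (R : realType) (d : Order.disp_t) (V : finOrderType d) (r : nat)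
    (A : V -> V -> R) : Prop :=
  forall (I J : {set V}) (eqJI : #|J| = #|I|),
    (#|I| <= r)%N -> 0 <= minor A eqJI.

(* Main.v *)
Require Import Defs.
From mathcomp Require Import all_boot all_order all_algebra all_fingroup.
From mathcomp Require Import reals.
From mathcomp Require Import ring zify.

Import Order.TTheory GRing.Theory Num.Theory.
Local Open Scope ring_scope.

(** The cycle through the marked vertex is contracted one vertex at a time.  If
    [s] is the image of [v <> s] under a permutation, composing with the
    transposition of [v] and [s] fixes [s], shortens the cycle of [v] by one and
    flips the sign.  After [a - 1] contractions the sign of the cycle sum is used
    up and it reads ([cycle_sum_walk]): the sum over walks from [v] through
    [a - 1] distinct other vertices, ending at [e], of the product of the entries
    along the walk times the determinant of order [k + 1] obtained from the
    principal submatrix on the unvisited vertices by adding the row of [e] and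
    the column of [v] ([slot]).  A single such determinant may be negative,
    because its rows need not be in order; only the sum over walks is
    nonnegative.

    The core is [walks_nonnegP], on an ordered list [G ++ z :: X].  The walks
    visit vertices of [X] only, the vertices of [G] are spectators that occur in
    the determinant but are never visited, the column is that of [z], and the
    first step is weighted by a nonnegative row [y] that has to be admissible
    ([adm_row]), as the rows labelled by vertices left of [X] are
    ([adm_row_left]).  The proof is by induction on the number of vertices.
    - The first spectator [g] is used as a pivot.  The determinants become those
      of the Schur complement, which is totally nonnegative of order one less.
      The entries along the walk are those of the Schur complement plus a
      nonnegative rank-one matrix built from row [g] and column [g], and
      [walks_mono] shows that dropping this matrix does not increase the sum.
    - Without spectators and with a single step, the Laplace expansion
      [ldet_laplace] turns the sum into the difference of the two sides of a
      Fischer-type inequality ([fischer]).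
    - Without spectators and with more steps, expanding the determinants along
      column [z] instead of along the last row of the walk exchanges the last
      step for a step into [z] ([walks_last_split]).  In this form the vertices
      of [X] can be made spectators one by one, in increasing order, because the
      terms lost each time are nonnegative by induction ([last_split_cons],
      [last_split_nonneg]).

    For the theorem, let [L] and [R] be the vertices left and right of [v].  The
    walks that have stayed in [L] and cross to [R] at some point contribute at
    least as much as if they never crossed back, and these contributions add up
    to a sum covered by [walks_nonnegP], with the vertices of [L] as spectators;
    the same holds with the two sides exchanged, by reversing the order
    ([walk_split_sides]).  Hence the sum over all walks is at least the sum over
    the walks that stay on one side of [v], which is nonnegative. *)

Set Implicit Arguments.
Unset Strict Implicit.
Unset Printing Implicit Defensive.

(** * Determinants with rows and columns given by lists *)

Section ListDeterminants.
Variables (F : fieldType) (T : eqType).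
Implicit Types (r y : T -> F) (R : seq (T -> F)) (C : seq T).

(** Rows are functions on the column labels, so that a row foreign to the matrix
    can be added to rows of it.  The columns are mapped before they are indexed,
    so that no default label is needed. *)
Definition ldet R C : F :=
  \det (\matrix_(i < size R, j < size R)
          [seq nth (fun=> 0) R i c | c <- C]`_j).

Lemma ldet_dim n R C : size R = n ->
  ldet R C = \det (\matrix_(i < n, j < n) [seq nth (fun=> 0) R i c | c <- C]`_j).
Proof. by move<-. Qed.

Lemma ldet_nil C : ldet [::] C = 1.
Proof. exact: det_mx00. Qed.

Lemma eq_ldet (S : eqType) (f g : S -> T -> F) (N : seq S) C :
  (forall x c, x \in N -> c \in C -> f x c = g x c) ->
  ldet (map f N) C = ldet (map g N) C.
Proof.
move=> fg; rewrite (ldet_dim _ (size_map f N)) (ldet_dim _ (size_map g N)).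
congr (\det _); apply/matrixP => i j; rewrite !mxE.
case: N fg i j => [|x0 N] fg i j; first by case: i.
rewrite !(nth_map x0) //; congr (_`_ _); apply/eq_in_map => c cC.
by apply: fg => //; apply: mem_nth.
Qed.

Lemma eq_ldet_head r r' R C : {in C, r =1 r'} -> ldet (r :: R) C = ldet (r' :: R) C.
Proof.
move=> rr'; congr (\det _); apply/matrixP => i j; rewrite !mxE.
case: i => [[|i] hi] //=; congr (_`_ _); exact/eq_in_map.
Qed.

Lemma ldet_swap_rows r1 r2 R C : ldet [:: r1, r2 & R] C = - ldet [:: r2, r1 & R] C.
Proof.
pose i0 : 'I_(size R).+2 := ord0; pose i1 : 'I_(size R).+2 := lift ord0 ord0.
rewrite /ldet /= -[in RHS]mulN1r.
rewrite -[X in _ = _ * X]det_tr.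
set M := \matrix_(i, j) _; set N := (X in _ = _ * \det X^T).
have -> : M = xrow i0 i1 N.
  apply/matrixP => i j; rewrite !mxE.
  by case: tpermP => [->|->|] //=; case: i => [[|[|i]] hi] //= h1 h2; exfalso;
    [apply: h1|apply: h2]; apply: val_inj.
by rewrite xrowE det_mulmx det_tr det_perm odd_tperm /= expr1.
Qed.

Lemma ldet_swap_cols c1 c2 R C : size R = (size C).+2 ->
  ldet R [:: c1, c2 & C] = - ldet R [:: c2, c1 & C].
Proof.
move=> sR; rewrite !(ldet_dim _ sR).
pose i0 : 'I_(size C).+2 := ord0; pose i1 : 'I_(size C).+2 := lift ord0 ord0.
set M := \matrix_(i, j) _; set N := (X in _ = - \det X).
have -> : M = xcol i0 i1 N.
  apply/matrixP => i j; rewrite !mxE.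
  by case: tpermP => [->|->|] //=; case: j => [[|[|j]] hj] //= h1 h2; exfalso;
    [apply: h1|apply: h2]; apply: val_inj.
by rewrite xcolE det_mulmx det_perm odd_tperm /= expr1 mulrN1.
Qed.

Lemma ldet_lin a r r' R C :
  ldet ((fun c => a * r c + r' c) :: R) C = a * ldet (r :: R) C + ldet (r' :: R) C.
Proof.
rewrite /ldet -[X in _ = _ + X]mul1r.
apply: (@determinant_multilinear _ _ _ _ _ ord0).
- apply/rowP => j; rewrite !mxE /=.
  have [jC|Cj] := ltnP j (size C); last first.
    by rewrite !nth_default ?size_map // mulr0 mul1r addr0.
  by case: C j jC => // c0 C j jC; rewrite !(nth_map c0) //= mul1r.
- by apply/matrixP => i j; rewrite !mxE /=.
- by apply/matrixP => i j; rewrite !mxE /=.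
Qed.

Lemma ldet_head0 R C : ldet ((fun=> 0) :: R) C = 0.
Proof.
have := ldet_lin 1 (fun=> 0) (fun=> 0) R C.
rewrite (eq_ldet_head (r' := fun=> 0)); last by move=> c _; rewrite mulr0 addr0.
by rewrite mul1r -[LHS]addr0 => /addrI <-.
Qed.

Lemma ldet_lin_sum (I : Type) (s : seq I) (a : I -> F) (f : I -> T -> F) R C :
  ldet ((fun c => \sum_(i <- s) a i * f i c) :: R) C
    = \sum_(i <- s) a i * ldet (f i :: R) C.
Proof.
elim: s => [|i s IH].
  rewrite big_nil (eq_ldet_head (r' := fun=> 0)) ?ldet_head0 // => c _.
  by rewrite big_nil.
rewrite big_cons -IH -ldet_lin; apply: eq_ldet_head => c _; by rewrite big_cons.
Qed.

Lemma ldet_row0 r c R C : size R = size C -> {in C, forall x, r x = 0} ->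
  ldet (r :: R) (c :: C) = r c * ldet R C.
Proof.
move=> sRC r0; rewrite /ldet (expand_det_row _ ord0) /= big_ord_recl big1 ?addr0.
  rewrite mxE /= /cofactor /= expr0 mul1r; congr (_ * \det _).
  by apply/matrixP => i j; rewrite !mxE.
move=> j _; have jC : (j < size C)%N by rewrite -sRC.
by rewrite mxE /= (nth_map c) // r0 ?mem_nth // mul0r.
Qed.

Lemma ldet_col0 r c R C : size R = size C ->
    (forall i, (i < size R)%N -> nth (fun=> 0) R i c = 0) ->
  ldet (r :: R) (c :: C) = r c * ldet R C.
Proof.
move=> sRC r0; rewrite /ldet (expand_det_col _ ord0) /= big_ord_recl big1 ?addr0.
  rewrite mxE /= /cofactor /= expr0 mul1r; congr (_ * \det _).
  by apply/matrixP => i j; rewrite !mxE.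
by move=> j _; rewrite mxE /= r0 ?mul0r //; apply: ltn_ord.
Qed.

Lemma ldet_elim r (f : (T -> F) -> F) R C :
  ldet (r :: [seq (fun c => x c - f x * r c) | x <- R]) C = ldet (r :: R) C.
Proof.
rewrite (@ldet_dim (1 + size R)) /= ?size_map // [RHS](@ldet_dim (1 + size R)) //.
pose v : 'cV[F]_(size R) := \col_i - f (nth (fun=> 0) R i).
set M := (X in _ = \det X).
set N := (X in \det X = _).
have -> : N = block_mx 1%:M 0 v 1%:M *m M.
  rewrite -[M in RHS]vsubmxK mul_block_col !mul1mx mul0mx addr0.
  apply/matrixP => i j; rewrite -[i]splitK; case: (split i) => {}i /=.
    by rewrite col_mxEu !mxE /= (ord1 i).
  rewrite col_mxEd !mxE big_ord1 !mxE /=.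
  have [jC|Cj] := ltnP j (size C); last first.
    by rewrite !(nth_default 0) ?size_map // mulr0 addr0.
  case: C N M j jC => // c0 C _ _ j jC.
  by rewrite !(nth_map c0) //= add0n (nth_map (fun=> 0)) // mulNr addrC.
by rewrite det_mulmx det_lblock !det1 !mul1r.
Qed.

Definition eliminate r0 c0 r : T -> F := fun c => r c - r c0 / r0 c0 * r0 c.

Lemma ldet_pivot r0 c0 R C : r0 c0 != 0 -> size R = size C ->
  ldet (r0 :: R) (c0 :: C) = r0 c0 * ldet (map (eliminate r0 c0) R) C.
Proof.
move=> r0c0 sRC; rewrite -(ldet_elim r0 (fun x => x c0 / r0 c0)).
rewrite ldet_col0 ?size_map // => i iR.
by rewrite (nth_map (fun=> 0)) //= divfK // subrr.
Qed.

(** Permuting rows and columns simultaneously gives the sign twice. *)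
Lemma ldet_perm (S : eqType) (f : S -> T -> F) (g : S -> T) L L' :
  perm_eq L L' -> ldet (map f L) (map g L) = ldet (map f L') (map g L').
Proof.
move=> LL'; have sL := perm_size LL'.
rewrite !(@ldet_dim (size L')) ?size_map //.
case: L' LL' sL => [/perm_nilP -> //|x0 L1]; set L' := x0 :: L1 => LL' sL.
have /tuple_permP[p Lp] : perm_eq L (in_tuple L') by [].
set M := (X in _ = \det X).
set N := (X in \det X = _).
suff -> : N = row_perm p (col_perm p M).
  by rewrite row_permE col_permE !det_mulmx !det_perm odd_permV mulrCA -expr2
    sqrr_sign mulr1.
apply/matrixP => i j; rewrite !mxE.
have Ln (h : 'I_(size L')) : nth x0 L h = nth x0 L' (p h).
  by rewrite Lp (nth_map h) ?size_enum_ord // nth_ord_enum (tnth_nth x0).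
by rewrite -!map_comp !(nth_map x0) ?sL //= !Ln.
Qed.

End ListDeterminants.

Lemma ldet_rev (F : fieldType) (S T : eqType) (A : S -> T -> F) N C :
  size N = size C -> ldet (map A (rev N)) (rev C) = ldet (map A N) C.
Proof.
move=> sNC.
have E (N' : seq S) (C' : seq T) : size N' = size C' ->
    ldet (map A N') C'
    = ldet (map (A \o fst) (zip N' C')) (map snd (zip N' C')).
  move=> s; rewrite map_comp -/(unzip1 _) -/(unzip2 _).
  by rewrite unzip1_zip ?unzip2_zip ?s.
rewrite E ?size_rev // E //; apply: ldet_perm.
by rewrite -rev_zip // perm_rev.
Qed.

Lemma ldet_tr (F : fieldType) (S T : eqType) (A : S -> T -> F) N C :
  size N = size C -> ldet (map A N) C = ldet (map (fun c n => A n c) C) N.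
Proof.
move=> sNC; rewrite (@ldet_dim _ _ (size C)) ?size_map //.
rewrite [RHS](@ldet_dim _ _ (size C)) ?size_map // -det_tr.
congr (\det _); apply/matrixP => i j; rewrite !mxE.
case: N sNC i j => [|n0 N]; case: C => [|c0 C] // sNC i j; first by case: i.
by rewrite !(nth_map n0) ?(nth_map c0) ?sNC.
Qed.

Section Slots.
Variables (F : fieldType) (T : eqType).
Implicit Types (A : T -> T -> F) (y : T -> F).

Lemma ldet1 y z : ldet [:: y] [:: z] = y z.
Proof. by rewrite ldet_row0 // ldet_nil mulr1. Qed.

Lemma ldet_col0_map (S : eqType) (A : S -> T -> F) r c N C :
    size N = size C -> {in N, forall n, A n c = 0} ->
  ldet (r :: map A N) (c :: C) = r c * ldet (map A N) C.
Proof.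
move=> sNC A0; apply: ldet_col0 => [|i]; rewrite size_map //.
by case: N sNC A0 => // n0 N _ A0 iN; rewrite (nth_map n0) // A0 // mem_nth.
Qed.

Lemma ldet2 (r1 r2 : T -> F) c1 c2 :
  ldet [:: r1; r2] [:: c1; c2] = r1 c1 * r2 c2 - r1 c2 * r2 c1.
Proof.
rewrite /ldet /= (expand_det_row _ ord0) !big_ord_recl big_ord0 addr0.
rewrite /cofactor !det_mx11 !mxE /= expr0 expr1.
by ring.
Qed.

Lemma ldet_perm_tail A y z Y Y' : perm_eq Y Y' ->
  ldet (y :: map A Y) (z :: Y) = ldet (y :: map A Y') (z :: Y').
Proof.
move=> YY'; have pY : perm_eq (None :: map Some Y) (None :: map Some Y').
  by rewrite perm_cons perm_map.
have := ldet_perm (oapp A y) (oapp id z) pY.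
by rewrite /= -!map_comp !(eq_map (g := A)) // !(eq_map (g := id)) // !map_id.
Qed.

(** Only row [e] and column [z] may be out of place: the remaining rows and
    columns are both labelled by [L], so the order of [L] does not matter. *)
Definition slot A e z L := ldet (A e :: map A L) (z :: L).

Lemma slot_perm A e z L L' : perm_eq L L' -> slot A e z L = slot A e z L'.
Proof. exact: ldet_perm_tail. Qed.

Lemma slot_tr A e z L : slot A e z L = slot (fun i j => A j i) z e L.
Proof. by rewrite /slot (@ldet_tr _ _ _ A (e :: L) (z :: L)). Qed.

(** Expansion along the row [y].  In the term of [s], moving the row and the
    column of [s] to the front together costs no sign, and exchanging the columns
    [s] and [z] gives the minus sign. *)
Lemma ldet_laplace A y z Y : uniq (z :: Y) ->
  ldet (y :: map A Y) (z :: Y) =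
    y z * ldet (map A Y) Y - \sum_(s <- Y) y s * slot A s z (rem s Y).
Proof.
move=> /= /andP[zY uY].
(* [y] is written in the basis of unit rows. *)
rewrite (eq_ldet_head (r' := fun c => \sum_(s <- z :: Y) y s * (s == c)%:R)).
  rewrite ldet_lin_sum big_cons -sumrN; congr (_ + _).
    rewrite ldet_row0 ?size_map // ?eqxx ?mul1r // => x xY.
    by case: eqP zY => // ->; rewrite xY.
  apply: eq_big_seq => s sY; rewrite -mulrN; congr (_ * _).
  rewrite (ldet_perm_tail _ _ _ (perm_to_rem sY)) /= ldet_swap_cols; last first.
    by rewrite /= size_map.
  rewrite ldet_row0 /= ?size_map // ?eqxx ?mul1r // => x.
  rewrite inE => /predU1P[->|]; first by case: eqP zY => // <-; rewrite sY.
  by rewrite mem_rem_uniq // !inE eq_sym => /andP[/negbTE->].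
move=> c cY /=; rewrite (bigD1_seq c) //= ?zY // eqxx mulr1 big1 ?addr0 //.
by move=> i /negbTE->; rewrite mulr0.
Qed.

End Slots.

Section Fischer.
Variables (F : realFieldType) (S T : eqType).

(** The minors of order 2 at a zero entry [A n0 c0] are [- A n0 c * A n c0]. *)
Lemma zero_corner (A : S -> T -> F) n0 c0 (N : seq S) (C : seq T) :
    A n0 c0 = 0 -> {in N, forall n, 0 <= A n c0} -> {in C, forall c, 0 <= A n0 c} ->
    {in N & C, forall n c, 0 <= ldet [:: A n0; A n] [:: c0; c]} ->
  {in C, forall c, A n0 c = 0} \/ {in N, forall n, A n c0 = 0}.
Proof.
move=> A00 Ncol Nrow N2.
have [/allP C0|/allPn[c cC nz]] := boolP (all (fun c => A n0 c == 0) C).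
  by left=> c /C0/eqP.
right=> n nN; apply/eqP; rewrite eq_le Ncol // andbT.
have := N2 n c nN cC; rewrite ldet2 A00 mul0r add0r oppr_ge0.
by rewrite pmulr_rle0 // lt0r nz Nrow.
Qed.

(** Induction by pivoting on the first row and column of the block [N], [C].  The
    difference is the pivot times the difference for the pivoted block, plus
    [y c1 * A n1 z] times a minor.  The row [y] and the column [z] stand before
    the block, so exchanging them with the pivot flips the signs of the minors
    through [y] and of those through [z]; the sign [eps] keeps track of this, and
    only its square enters the conclusion. *)
Lemma fischer (eps : F) (A : S -> T -> F) y z N C :
    eps * eps = 1 -> size N = size C ->
    (forall R C', subseq R N -> subseq C' C -> size R = size C' ->
       0 <= ldet (map A R) C') ->
    (forall R C', subseq R N -> subseq C' C -> size R = (size C').+1 ->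
       0 <= eps * ldet (map A R) (z :: C')) ->
    (forall R C', subseq R N -> subseq C' C -> size C' = (size R).+1 ->
       0 <= eps * ldet (y :: map A R) C') ->
  0 <= y z * ldet (map A N) C - ldet (y :: map A N) (z :: C).
Proof.
elim: N C eps A y => [|n1 N IH] [|c1 C] // eps A y eps2 sNC H1 H2 H3.
  by rewrite ldet1 /= ldet_nil mulr1 subrr.
case: sNC => sNC; set p := A n1 c1.
have ss (U : eqType) (x : U) s : subseq [:: x] (x :: s) by rewrite /= eqxx sub0seq.
have p0 : 0 <= p by have := H1 [:: n1] [:: c1]; rewrite /= ldet1 !eqxx !sub0seq; exact.
have Hn1z : 0 <= eps * A n1 z.
  by have := H2 [:: n1] [::]; rewrite /= ldet1 !eqxx !sub0seq; exact.
have Hyc1 : 0 <= eps * y c1.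
  by have := H3 [::] [:: c1]; rewrite /= ldet1 !eqxx !sub0seq; exact.
have e2 (a b : F) : 0 <= eps * a -> 0 <= eps * b -> 0 <= a * b.
  by move=> ha hb; have := mulr_ge0 ha hb; rewrite mulrACA eps2 mul1r.
have subc (U : eqType) (x : U) s t : subseq s t -> subseq s (x :: t).
  by move=> st; apply: subseq_trans st (subseq_cons _ _).
have [pz|pnz] := eqVneq p 0.
  (* One of the two determinants in the conclusion vanishes, and the other one
     factors into two quantities of sign [eps]. *)
  have [||n c nN cC|r0|c0] := @zero_corner A n1 c1 N C pz.
  - move=> n nN; have := H1 [:: n] [:: c1]; rewrite ldet1; apply=> //.
    by apply: subc; rewrite sub1seq.
  - move=> c cC; have := H1 [:: n1] [:: c]; rewrite ldet1; apply=> //.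
    by apply: subc; rewrite sub1seq.
  - by apply: (H1 [:: n1; n] [:: c1; c]); rewrite //= eqxx sub1seq.
  - rewrite /= ldet_row0 ?size_map // -/p pz mul0r mulr0 sub0r ldet_swap_rows opprK.
    rewrite ldet_row0 /= ?size_map ?sNC //; last first.
      by move=> c; rewrite inE => /predU1P[->|/r0].
    by apply: e2 => //; apply: H3; rewrite ?subseq_refl ?subseq_cons /= ?sNC.
  - rewrite /= ldet_col0_map // -/p pz mul0r mulr0 sub0r.
    rewrite ldet_swap_cols ?opprK; last by rewrite /= size_map sNC.
    rewrite (@ldet_col0_map _ _ _ A y c1 (n1 :: N)) /= ?sNC //; last first.
      by move=> n; rewrite inE => /predU1P[->|/c0].
    by apply: e2 => //; apply: (H2 (n1 :: N));
      rewrite ?subseq_refl ?subseq_cons /= ?sNC.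
have pp : 0 < p by rewrite lt0r pnz.
pose A1 n := eliminate (A n1) c1 (A n); pose y1 := eliminate (A n1) c1 y.
have piv R C' : size R = size C' ->
    ldet (map A (n1 :: R)) (c1 :: C') = p * ldet (map A1 R) C'.
  by move=> sR; rewrite /= ldet_pivot ?size_map // -map_comp.
have pivy R C' : size C' = (size R).+1 ->
    ldet (y :: map A (n1 :: R)) (c1 :: C') = - (p * ldet (y1 :: map A1 R) C').
  move=> sR; rewrite /= ldet_swap_rows ldet_pivot ?size_map /= ?size_map //.
  by rewrite -map_comp.
have f0 : 0 <= y1 z * ldet (map A1 N) C - ldet (y1 :: map A1 N) (z :: C).
  apply: (IH C (- eps)) => // [|R C' sR sC sRC|R C' sR sC sRC|R C' sR sC sRC].
  - by rewrite mulrNN.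
  - rewrite -(pmulr_rge0 _ pp) -piv //; apply: H1; rewrite /= ?eqxx //.
    by congr _.+1.
  - rewrite -(pmulr_rge0 _ pp) mulrCA -piv // mulNr -mulrN -ldet_swap_cols.
      by apply: H2; rewrite /= ?eqxx //; congr _.+1.
    by rewrite size_map /= sRC.
  - rewrite -(pmulr_rge0 _ pp) mulrCA mulNr -mulrN -pivy //.
    by apply: H3; rewrite /= ?eqxx //; congr _.+1.
rewrite piv // ldet_swap_cols ?pivy ?sNC //=; last by rewrite size_map sNC.
have := H1 (n1 :: N) (c1 :: C); rewrite piv // pmulr_rge0 //.
rewrite !subseq_refl /= sNC => /(_ isT isT erefl) D0.
rewrite opprK.
have -> : y z * (p * ldet (map A1 N) C) - p * ldet (y1 :: map A1 N) (z :: C)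
  = p * (y1 z * ldet (map A1 N) C - ldet (y1 :: map A1 N) (z :: C))
    + (y c1 * A n1 z) * ldet (map A1 N) C.
  by rewrite /y1 /eliminate -/p; field.
by apply: addr_ge0; apply: mulr_ge0 => //; apply: e2.
Qed.

End Fischer.

(** * Total nonnegativity, Schur complements and admissible rows *)

Section TopRows.
Variables (F : realFieldType) (T : eqType).
Implicit Types (A : T -> T -> F) (y : T -> F) (r : nat) (L G X : seq T).

Lemma subseqW (x : T) L L' : subseq L L' -> subseq L (x :: L').
Proof. by move=> LL'; apply: subseq_trans LL' (subseq_cons _ _). Qed.

Lemma subseq_cons2 (x : T) L L' : subseq (x :: L) (x :: L') = subseq L L'.
Proof. by rewrite /= eqxx. Qed.

(** When [A g g = 0] this is [A] itself, by the convention for the inverse of 0;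
    hence the closure properties below hold without a condition on the pivot. *)
Definition schur A g : T -> T -> F := fun x => eliminate (A g) g (A x).

Lemma schur0 A g x : A g g = 0 -> schur A g x =1 A x.
Proof. by move=> Agg c; rewrite /schur /eliminate Agg invr0 mulr0 mul0r subr0. Qed.

Lemma ldet_schur A g R C : A g g != 0 -> size R = size C ->
  ldet (map A (g :: R)) (g :: C) = A g g * ldet (map (schur A g) R) C.
Proof. by move=> gg sRC; rewrite /= ldet_pivot ?size_map // -map_comp. Qed.

Definition tp_on r A L := forall R C, subseq R L -> subseq C L ->
  size R = size C -> (size R <= r)%N -> 0 <= ldet (map A R) C.

(** Total nonnegativity of the matrix obtained by putting [y] above the rows [L],
    as far as minors through [y] are concerned. *)
Definition top_row r A L y := forall R C, subseq R L -> subseq C L ->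
  size C = (size R).+1 -> (size C <= r)%N -> 0 <= ldet (y :: map A R) C.

(** Being a [top_row] for [X] after the vertices of [G] have been eliminated from
    the matrix but not from [y].  For a totally nonnegative matrix this is weaker
    than being a [top_row] for [G ++ X] ([adm_row_of_top]), and it also holds for a
    row of the matrix that stands among the rows of [G] ([adm_row_left]). *)
Fixpoint adm_row r A G X y : Prop :=
  if G is g :: G' then adm_row r.-1 (schur A g) G' X y else top_row r A X y.

Lemma tp_on_sub r A L L' : subseq L' L -> tp_on r A L -> tp_on r A L'.
Proof.
by move=> sL AL R C RL CL; apply: AL;
  [apply: subseq_trans RL sL|apply: subseq_trans CL sL].
Qed.

Lemma tp_on_tr r A L : tp_on r A L -> tp_on r (fun i j => A j i) L.
Proof. by move=> AL R C RL CL sRC sR; rewrite ldet_tr //; apply: AL; rewrite -?sRC. Qed.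

Lemma tp_on_rev r A L : tp_on r A L -> tp_on r A (rev L).
Proof.
move=> AL R C RL CL sRC sR; rewrite -ldet_rev //; apply: AL; rewrite ?size_rev //.
  by rewrite -subseq_rev revK.
by rewrite -subseq_rev revK.
Qed.

Lemma tp_on_entry r A L : tp_on r.+1 A L -> {in L &, forall x c, 0 <= A x c}.
Proof.
by move=> AL x c xL cL; rewrite -(ldet1 (A x) c);
  apply: (AL [:: x] [:: c]); rewrite ?sub1seq.
Qed.

Lemma top_row_leq r r' A L y : (r' <= r)%N -> top_row r A L y -> top_row r' A L y.
Proof. by move=> rr' AL R C RL CL sRC sR; apply: AL => //; apply: leq_trans rr'. Qed.

Lemma top_row_sub r A L L' y : subseq L' L -> top_row r A L y -> top_row r A L' y.
Proof.
by move=> sL AL R C RL CL; apply: AL;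
  [apply: subseq_trans RL sL|apply: subseq_trans CL sL].
Qed.

Lemma tp_on_schur r A g L : tp_on r A (g :: L) -> tp_on r.-1 (schur A g) L.
Proof.
case: r => [|r] AL R C RL CL sRC sR.
  by move: sR; rewrite leqn0 => /nilP->; rewrite ldet_nil.
have [gg0|gg] := eqVneq (A g g) 0.
  rewrite (@eq_ldet _ _ _ _ A) => [|x c _ _]; last exact: schur0.
  by apply: AL => //; rewrite ?subseqW // (leq_trans sR).
have ggp : 0 < A g g by rewrite lt0r gg (tp_on_entry AL) ?mem_head.
rewrite -(pmulr_rge0 _ ggp) -ldet_schur //.
by apply: AL; rewrite ?subseq_cons2 //= sRC.
Qed.

(** Adding multiples of row [g] to the other rows does not change the minors
    through row [g]. *)
Lemma top_row_head r A g L : tp_on r A (g :: L) -> top_row r (schur A g) L (A g).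
Proof.
move=> AL R C RL CL sRC sC.
have -> : map (schur A g) R
    = [seq (fun c => x c - x g / A g g * A g c) | x <- map A R].
  by rewrite -map_comp.
rewrite (ldet_elim (A g) (fun x => x g / A g g)).
by apply: (AL (g :: R)); rewrite ?subseq_cons2 ?subseqW //= -sRC.
Qed.

(** A minor through [y] of the Schur complement, times the pivot, is
    [y g * M - M'] for a minor [M] of [A] and the minor [M'] with the row [y] and
    the column [g] added.  This difference is an instance of [fischer] with
    [z := g]. *)
Lemma top_row_schur r A g L y :
  tp_on r A (g :: L) -> top_row r A (g :: L) y -> top_row r (schur A g) L y.
Proof.
move=> AL yL R C RL CL sRC sC.
have [gg0|gg] := eqVneq (A g g) 0.
  have -> : ldet (y :: map (schur A g) R) C = ldet (y :: map A R) C.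
    have := @eq_ldet F T (option T) (oapp (schur A g) y) (oapp A y)
      (None :: map Some R) C.
    rewrite /= -!map_comp; apply=> -[x|] c // _ _ /=; exact: schur0.
  by apply: yL; rewrite ?subseqW.
case: r AL yL sC => [|r] AL yL sC; first by rewrite sRC in sC.
have ggp : 0 < A g g by rewrite lt0r gg (tp_on_entry AL) ?mem_head.
pose y1 := eliminate (A g) g y.
have E1 : ldet (y :: map A (g :: R)) (g :: C)
          = - (A g g * ldet (y1 :: map (schur A g) R) C).
  by rewrite /= ldet_swap_rows ldet_pivot /= ?size_map // -map_comp.
have E2 : ldet (y1 :: map (schur A g) R) C
    = ldet (y :: map (schur A g) R) C - y g / A g g * ldet (map A (g :: R)) C.
  rewrite (eq_ldet_head (r' := fun c => - (y g / A g g) * A g c + y c)); last first.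
    by move=> c _; rewrite /y1 /eliminate; ring.
  rewrite ldet_lin addrC mulNr; congr (_ - _ * _).
  have -> : map (schur A g) R
      = [seq (fun c => x c - x g / A g g * A g c) | x <- map A R].
    by rewrite -map_comp.
  by rewrite (ldet_elim (A g) (fun x => x g / A g g)).
rewrite -(pmulr_rge0 _ ggp).
have -> : A g g * ldet (y :: map (schur A g) R) C
    = y g * ldet (map A (g :: R)) C - ldet (y :: map A (g :: R)) (g :: C).
  by rewrite E1 E2; field.
apply: (@fischer _ _ _ 1) => //; first by rewrite mulr1.
- move=> R' C' sR' sC' sRC'; apply: AL => //.
  + by apply: subseq_trans sR' _; rewrite subseq_cons2.
  + by apply: subseq_trans sC' _; apply: subseqW.
  + by rewrite sRC'; apply: leq_trans (size_subseq sC') sC.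
- move=> R' C' sR' sC' sRC'; rewrite mul1r; apply: AL => //.
  + by apply: subseq_trans sR' _; rewrite subseq_cons2.
  + by rewrite subseq_cons2; apply: subseq_trans sC' CL.
  + by apply: leq_trans (size_subseq sR') _; rewrite /= -sRC.
- move=> R' C' sR' sC' sRC'; rewrite mul1r; apply: yL => //.
  + by apply: subseq_trans sR' _; rewrite subseq_cons2.
  + by apply: subseq_trans sC' _; apply: subseqW.
  + by apply: leq_trans (size_subseq sC') sC.
Qed.

Lemma adm_row_of_top r A G X y :
  tp_on r A (G ++ X) -> top_row r A (G ++ X) y -> adm_row r A G X y.
Proof.
elim: G r A => //= g G IH r A AL yL; apply: IH; first exact: tp_on_schur.
by apply: (top_row_leq (leq_pred r)); apply: top_row_schur.
Qed.

Lemma adm_row_lin a r A G X y1 y2 : 0 <= a ->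
    adm_row r A G X y1 -> adm_row r A G X y2 ->
  adm_row r A G X (fun c => a * y1 c + y2 c).
Proof.
move=> a0; elim: G r A => [|g G IH] r A /=; last exact: IH.
move=> h1 h2 R C RX CX sRC sC; rewrite ldet_lin.
by apply: addr_ge0; [apply: mulr_ge0 => //; apply: h1|apply: h2].
Qed.

Lemma eq_adm_row r A G X y1 y2 : y1 =1 y2 -> adm_row r A G X y1 -> adm_row r A G X y2.
Proof.
move=> y12; elim: G r A => [|g G IH] r A /=; last exact: IH.
move=> h1 R C RX CX sRC sC.
rewrite (eq_ldet_head (r' := y1)) => [|c _]; last by rewrite y12.
exact: h1.
Qed.

Lemma adm_row_sub r A G X X' y :
  subseq X' X -> adm_row r A G X y -> adm_row r A G X' y.
Proof.
by move=> sX; elim: G r A => [|g G IH] r A /=; [apply: top_row_sub|apply: IH].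
Qed.

Lemma adm_row0 A G X y : adm_row 0 A G X y.
Proof.
elim: G A => [|g G IH] A /=; last exact: IH.
by move=> R C RX CX sRC; rewrite sRC.
Qed.

(** For a vertex [g] left of [p], the row of [p] is its row in the Schur
    complement plus a nonnegative multiple of row [g]; both are admissible after
    the elimination of [g]. *)
Lemma adm_row_left r A G1 p G2 X :
  tp_on r A (G1 ++ p :: G2 ++ X) -> adm_row r A (G1 ++ G2) X (A p).
Proof.
elim: G1 r A => [|g G1 IH] r A AL /=.
  apply: adm_row_of_top; first exact: tp_on_sub (subseq_cons _ _) AL.
  by move=> R C RL CL sRC sC; apply: (AL (p :: R));
    rewrite ?subseq_cons2 ?subseqW //= -sRC.
case: r AL => [|r] AL; first exact: adm_row0.
have gA : adm_row r (schur A g) (G1 ++ G2) X (A g).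
  have AL' : tp_on r.+1 A (g :: (G1 ++ G2) ++ X).
    apply: tp_on_sub AL.
    by rewrite cat_cons subseq_cons2 -catA cat_subseq // subseq_cons.
  apply: adm_row_of_top; first exact: tp_on_schur AL'.
  by apply: (top_row_leq (leqnSn r)); apply: top_row_head.
have pos : 0 <= A p g / A g g.
  by apply: divr_ge0; apply: (tp_on_entry AL); rewrite !inE ?mem_cat ?inE ?eqxx ?orbT.
apply: eq_adm_row (adm_row_lin pos gA (IH _ _ (tp_on_schur AL))) => c.
by rewrite /schur /eliminate; ring.
Qed.

Lemma adm_row_rcons r A U x W y :
  tp_on r A (U ++ x :: W) -> adm_row r A U (x :: W) y -> adm_row r A (rcons U x) W y.
Proof.
elim: U r A => [|u U IH] r A /= AL yL.
  by apply: (top_row_leq (leq_pred r)); apply: top_row_schur.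
by apply: IH => //; apply: tp_on_schur.
Qed.

End TopRows.

(** * Sums over walks *)

Section RemSeq.
Variables (V : nmodType) (T : eqType).
Implicit Types X : seq T.

Lemma remC (s t : T) X : rem s (rem t X) = rem t (rem s X).
Proof.
elim: X => //= x X IH.
have [->|xt] := eqVneq x t; have [->|xs] //= := eqVneq _ s.
- by rewrite eqxx.
- by rewrite eqxx.
- by rewrite (negbTE xt) (negbTE xs) IH.
Qed.

Lemma exchange_rem X (f : T -> T -> V) : uniq X ->
  \sum_(s <- X) \sum_(t <- rem s X) f s t = \sum_(t <- X) \sum_(s <- rem t X) f s t.
Proof.
move=> uX.
under eq_bigr => s _ do rewrite rem_filter // big_filter.
under [RHS]eq_bigr => s _ do rewrite rem_filter // big_filter.
rewrite (exchange_big_dep predT) //=; apply: eq_bigr => t _.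
by apply: eq_bigl => s; rewrite eq_sym.
Qed.

Lemma perm_rem (s : T) X Y : perm_eq X Y -> perm_eq (rem s X) (rem s Y).
Proof.
move=> XY; have [sX|sX] := boolP (s \in X); last first.
  by rewrite !rem_id // -(perm_mem XY).
rewrite -(perm_cons s) -(permPl (perm_to_rem sX)) (perm_trans XY) //.
by rewrite perm_to_rem // -(perm_mem XY).
Qed.

End RemSeq.

Lemma exchange_split (R : comNzRingType) (T : eqType) (f y : T -> R)
    (g : T -> T -> seq T -> R) X : uniq X ->
  \sum_(s <- X) y s * \sum_(t <- rem s X) f t * g s t (rem t (rem s X))
    = \sum_(t <- X) f t * \sum_(s <- rem t X) y s * g s t (rem s (rem t X)).
Proof.
move=> uX; under eq_bigr do rewrite mulr_sumr.
rewrite exchange_rem //; apply: eq_bigr => t _; rewrite mulr_sumr.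
by apply: eq_bigr => s _; rewrite remC mulrCA.
Qed.

Section Walks.
Variables (F : realFieldType) (T : eqType).
Implicit Types (A P Q : T -> T -> F) (y : T -> F) (X G : seq T).

(** Sum over the sequences of [b] distinct vertices of [X], with weights [P] along
    the walk from [e] and a determinant of [Q] at the end; the vertices of [G] are
    never visited.  The two matrices differ only while a spectator is being
    eliminated. *)
Fixpoint walk b P Q e z X G : F :=
  if b is b'.+1 then \sum_(s <- X) P e s * walk b' P Q s z (rem s X) G
  else slot Q e z (G ++ X).

(** The number of steps is [b.+1], not [b]. *)
Definition walks b P Q y z X G : F :=
  \sum_(s <- X) y s * walk b P Q s z (rem s X) G.

(** The walk leaves with weights [y], and the factor [A t z] closes it at [z],
    while the determinant has the column of [t]. *)
Definition last_split b A y z X G : F :=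
  \sum_(t <- X) A t z * walks b A A y t (rem t X) G.

Lemma walkS b P Q e z X G : walk b.+1 P Q e z X G = walks b P Q (P e) z X G.
Proof. by []. Qed.

Lemma eq_walks b P Q y1 y2 z X G : {in X, y1 =1 y2} ->
  walks b P Q y1 z X G = walks b P Q y2 z X G.
Proof. by move=> y12; apply: eq_big_seq => s /y12->. Qed.

Lemma walks_lin b P Q a y1 y2 z X G :
  walks b P Q (fun c => a * y1 c + y2 c) z X G
   = a * walks b P Q y1 z X G + walks b P Q y2 z X G.
Proof.
rewrite /walks mulr_sumr -big_split /=.
by apply: eq_bigr => s _; rewrite mulrDl mulrA.
Qed.

Lemma walk_short b P Q e z X G : (size X < b)%N -> walk b P Q e z X G = 0.
Proof.
elim: b e X => // b IH e X; rewrite ltnS => Xb /=.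
rewrite big_seq big1 // => s sX; rewrite IH ?mulr0 //.
by rewrite size_rem //; case: X sX Xb.
Qed.

Lemma walks_short b P Q y z X G : (size X <= b)%N -> walks b P Q y z X G = 0.
Proof.
move=> Xb; rewrite /walks big_seq big1 // => s sX; rewrite walk_short ?mulr0 //.
by rewrite size_rem //; case: X sX Xb.
Qed.

Lemma walk_perm b P Q e z X X' G G' :
  perm_eq X X' -> perm_eq G G' -> walk b P Q e z X G = walk b P Q e z X' G'.
Proof.
move=> XX' GG'; elim: b e X X' XX' => [|b IH] e X X' XX' /=.
  by apply: slot_perm; apply: perm_cat.
rewrite (perm_big _ XX'); apply: eq_bigr => s _; congr (_ * _).
by apply: IH; apply: perm_rem.
Qed.

Lemma walks_perm b P Q y z X X' G G' :
  perm_eq X X' -> perm_eq G G' -> walks b P Q y z X G = walks b P Q y z X' G'.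
Proof.
move=> XX' GG'; rewrite /walks (perm_big _ XX'); apply: eq_bigr => s _; congr (_ * _).
by apply: walk_perm => //; apply: perm_rem.
Qed.

Lemma slot_schur Q e z g L : Q g g != 0 ->
  slot Q e z (g :: L) = Q g g * slot (schur Q g) e z L.
Proof.
move=> gg; rewrite /slot /= ldet_swap_rows ldet_swap_cols /= ?size_map // opprK.
by rewrite (@ldet_schur _ _ Q g (e :: L) (z :: L)).
Qed.

Lemma walk_schur b P Q e z X g G : Q g g != 0 ->
  walk b P Q e z X (g :: G) = Q g g * walk b P (schur Q g) e z X G.
Proof.
move=> gg; elim: b e X => [|b IH] e X /=; first exact: slot_schur.
by rewrite mulr_sumr; apply: eq_bigr => s _; rewrite IH mulrCA.
Qed.

Lemma walks_schur b P Q y z X g G : Q g g != 0 ->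
  walks b P Q y z X (g :: G) = Q g g * walks b P (schur Q g) y z X G.
Proof.
move=> gg; rewrite mulr_sumr; apply: eq_bigr => s _.
by rewrite walk_schur // mulrCA.
Qed.

(** Without steps, both sides are Laplace expansions of the same determinant, one
    along the row of [e] and one along the column of [z]; without spectators these
    expansions have no further terms.  A longer walk only adds a common first
    step. *)
Lemma walk_last_split b A e z X : uniq X -> z \notin X -> e \notin X ->
  walk b.+1 A A e z X [::] = \sum_(t <- X) A t z * walk b A A e t (rem t X) [::].
Proof.
elim: b e X => [|b IH] e X uX zX eX /=.
  have Le := @ldet_laplace _ _ A (A e) z X.
  have Lz := @ldet_laplace _ _ (fun i j => A j i) (fun i => A i z) e X.
  move: Le Lz; rewrite /= zX eX uX => /(_ isT) Le /(_ isT) Lz.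
  have LL : ldet (A e :: map A X) (z :: X)
      = ldet ((fun i => A i z) :: map (fun i j => A j i) X) (e :: X).
    by rewrite (@ldet_tr _ _ _ A (e :: X) (z :: X)).
  have LX := @ldet_tr _ _ _ A X X erefl.
  move: LL; rewrite Le Lz LX => /addrI/oppr_inj ->.
  by apply: eq_bigr => s _; rewrite -slot_tr.
under eq_big_seq => s sX.
  rewrite -/(walk b.+1 A A s z (rem s X) [::]) IH ?rem_uniq //; first last.
  - by rewrite mem_rem_uniqF.
  - by apply: contra zX; apply: mem_rem.
  over.
exact: (exchange_split _ _ (fun s t Y => walk b A A s t Y [::])).
Qed.

Lemma walks_last_split b A y z X : uniq X -> z \notin X ->
  walks b.+1 A A y z X [::] = last_split b A y z X [::].
Proof.
move=> uX zX; rewrite /walks.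
under eq_big_seq => s sX.
  rewrite walk_last_split ?rem_uniq //; first last.
  - by rewrite mem_rem_uniqF.
  - by apply: contra zX; apply: mem_rem.
  over.
exact: (exchange_split _ _ (fun s t Y => walk b A A s t Y [::])).
Qed.

End Walks.

Section Mono.
Variables (F : realFieldType) (T : eqType).
Implicit Types (A P Q : T -> T -> F) (y : T -> F) (X G : seq T).

(** Replacing [Q] by [P = Q + xi eta] at one step splits the sum in two.  The part
    with [xi eta] is a nonnegative multiple of a sum that starts afresh with the
    weights [eta], and this sum is nonnegative by hypothesis. *)
Lemma walks_mono b P Q (xi eta : T -> F) y z X G :
    (forall s c, P s c = Q s c + xi s * eta c) ->
    {in X &, forall s c, 0 <= Q s c} -> {in X, forall s, 0 <= xi s} ->
    {in X, forall s, 0 <= eta s} ->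
    (forall b' X', subseq X' X -> (size X' + b = size X + b')%N ->
       0 <= walks b' Q Q eta z X' G) ->
    {in X, forall s, 0 <= y s} ->
  walks b Q Q y z X G <= walks b P Q y z X G.
Proof.
move=> PQ; elim: b y X => [|b IH] y X Q0 xi0 eta0 W0 y0; first exact: lexx.
rewrite /walks !big_seq; apply: ler_sum => s sX.
apply: ler_wpM2l; first exact: y0.
have rX : subseq (rem s X) X by apply: rem_subseq.
have mX := mem_subseq rX.
have IH' y' : {in rem s X, forall c, 0 <= y' c} ->
    walks b Q Q y' z (rem s X) G <= walks b P Q y' z (rem s X) G.
  apply: IH => //.
  - by move=> t c /mX tX /mX cX; apply: Q0.
  - by move=> t /mX; apply: xi0.
  - by move=> t /mX; apply: eta0.
  - move=> b' X' sX' e; apply: W0; first exact: subseq_trans sX' rX.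
    move: e; rewrite size_rem //; case: X sX {Q0 xi0 eta0 y0 rX mX sX'} => //=.
    by move=> x X _; rewrite addnS => ->; rewrite addSn.
rewrite !walkS.
rewrite (@eq_walks _ _ _ _ _ (P s) (fun c => xi s * eta c + Q s c)); last first.
  by move=> c _; rewrite PQ addrC.
rewrite walks_lin -[X in X <= _]add0r; apply: lerD; last first.
  by apply: IH' => c /mX cX; apply: Q0.
apply: mulr_ge0; first exact: xi0.
apply: le_trans (IH' eta _); last by move=> c /mX; apply: eta0.
apply: W0 => //; rewrite size_rem //.
by case: X sX {Q0 xi0 eta0 y0 rX mX IH'} => //= x X _; lia.
Qed.

End Mono.

(** * Nonnegativity of one-sided sums over walks *)

Section Positivity.
Variables (F : realFieldType) (T : eqType).
Implicit Types (A P Q : T -> T -> F) (y : T -> F) (X G U W : seq T).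

(** The determinants have order [k.+1]: the [k + b.+1] vertices of [G] and [X]
    without the [b.+1] visited ones, and one more row and column. *)
Definition walks_nonneg n := forall A k b z y G X,
  (size G + size X < n)%N -> (size G + size X = k + b.+1)%N ->
  uniq (G ++ z :: X) -> tp_on k.+1 A (G ++ z :: X) ->
  adm_row k.+1 A G X y -> {in X, forall s, 0 <= y s} ->
  0 <= walks b A A y z X G.

Lemma slot_zero Q e z g L :
    {in [:: z, g & L], forall c, Q g c = 0} \/
    {in [:: e, g & L], forall x, Q x g = 0} ->
  slot Q e z (g :: L) = 0.
Proof.
rewrite /slot /= ldet_swap_rows; case=> [r0|c0].
  rewrite ldet_row0 /= ?size_map //; last first.
    by move=> c cL; apply: r0; rewrite inE cL orbT.
  by rewrite r0 ?mul0r ?oppr0 // mem_head.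
rewrite ldet_swap_cols /= ?size_map // opprK.
rewrite (@ldet_col0_map _ _ _ Q (Q g) g (e :: L) (z :: L)) //.
  by rewrite c0 ?mul0r // inE mem_head orbT.
by move=> n; rewrite !inE => /orP[/eqP->|nL]; apply: c0; rewrite !inE ?eqxx ?nL ?orbT.
Qed.

Lemma walk_zero b P Q e z X g G :
    {in [:: z, g & G ++ X], forall c, Q g c = 0} \/
    {in [:: e, g & G ++ X], forall x, Q x g = 0} ->
  walk b P Q e z X (g :: G) = 0.
Proof.
elim: b e X => [|b IH] e X H /=; first exact: slot_zero.
rewrite big_seq big1 // => s sX; rewrite IH ?mulr0 //.
case: H => H; [left|right] => x xX; apply: H; move: xX; rewrite !inE !mem_cat.
  by case/or4P=> [->|->|->|/mem_rem->]; rewrite ?orbT.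
by case/or4P=> [/eqP->|->|->|/mem_rem->]; rewrite ?sX ?orbT.
Qed.

Lemma walks0_nonneg A k z y X : size X = k.+1 -> uniq (z :: X) ->
    tp_on k.+1 A (z :: X) -> top_row k.+1 A X y ->
  0 <= walks 0 A A y z X [::].
Proof.
move=> sX uX AX yX.
have -> : walks 0 A A y z X [::]
    = y z * ldet (map A X) X - ldet (y :: map A X) (z :: X).
  by rewrite (ldet_laplace _ _ uX) opprB addrC subrK.
apply: (@fischer _ _ _ 1) => //; first by rewrite mulr1.
- move=> R C RX CX sRC; apply: AX => //; last by rewrite -sX size_subseq.
  + by rewrite (subseq_trans RX) ?subseq_cons.
  + by rewrite (subseq_trans CX) ?subseq_cons.
- move=> R C RX CX sRC; rewrite mul1r; apply: AX => //.
  + by rewrite (subseq_trans RX) ?subseq_cons.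
  + by rewrite subseq_cons2.
  + by rewrite -sX size_subseq.
- by move=> R C RX CX sRC; rewrite mul1r; apply: yX; rewrite // -sX size_subseq.
Qed.

(** The right-hand side differs from the left-hand side by the walks that visit
    [x].  Their part up to [x] has nonnegative weights, and the rest of the walk,
    from [x] to [z], is what the hypothesis controls.  For [m' = 0] the walk stops
    at [x]. *)
Lemma last_split_cons m A y z x W U :
    uniq (x :: W) -> 0 <= y x -> {in W, forall s, 0 <= y s} ->
    {in x :: W &, forall s c, 0 <= A s c} ->
    (forall m' W', subseq W' W -> (size W' + m = size W + m')%N ->
       0 <= \sum_(t <- W') A t z * walk m' A A x t (rem t W') U) ->
  last_split m A y z W (rcons U x) <=
    \sum_(t <- W) A t z * walks m A A y t (x :: rem t W) U.
Proof.
elim: m y W => [|m IH] y W /andP[xW uW] yx yW AW hit.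
  have E t : t \in W -> walks 0 A A y t (x :: rem t W) U
      = y x * walk 0 A A x t (rem t W) U + walks 0 A A y t (rem t W) (rcons U x).
    move=> tW; rewrite /walks big_cons /= eqxx; congr (_ + _).
    apply: eq_big_seq => s sW; congr (_ * _).
    have /negbTE-> : x != s by apply: contraNneq xW => ->; apply: mem_rem sW.
    by rewrite cat_rcons.
  rewrite [leRHS]big_seq; under eq_bigr => t tW do rewrite E // mulrDr mulrCA.
  rewrite big_split /= -!big_seq -mulr_sumr -[leLHS]add0r lerD ?lexx //.
  by apply: mulr_ge0 => //; apply: (hit 0%N).
have E t : t \in W -> walks m.+1 A A y t (x :: rem t W) U
    = y x * walk m.+1 A A x t (rem t W) U
      + \sum_(s <- rem t W) y s * walks m A A (A s) t (x :: rem s (rem t W)) U.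
  move=> tW; rewrite {1}/walks big_cons /= eqxx; congr (_ + _).
  apply: eq_big_seq => s sW.
  by have /negbTE-> : x != s by apply: contraNneq xW => ->; apply: mem_rem sW.
rewrite [leRHS]big_seq; under eq_bigr => t tW do rewrite E // mulrDr mulrCA.
rewrite big_split /= -!big_seq -mulr_sumr -[leLHS]add0r; apply: lerD.
  by apply: mulr_ge0 => //; apply: (hit m.+1).
rewrite -(exchange_split _ _ (fun s t Y => walks m A A (A s) t (x :: Y) U)) //.
rewrite /last_split.
rewrite -(exchange_split _ _ (fun s t Y => walks m A A (A s) t Y (rcons U x))) //.
rewrite !(big_seq _ _ W); apply: ler_sum => s sW; apply: ler_wpM2l; first exact: yW.
have mW := @mem_rem _ s W.
apply: IH.
- by rewrite /= rem_uniq // andbT; apply: contra xW => /mW.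
- by apply: AW; rewrite inE ?eqxx ?sW ?orbT.
- by move=> t /mW tW; apply: AW; rewrite inE ?tW ?sW ?orbT.
- move=> t c; rewrite !inE => tW cW; apply: AW; rewrite inE.
  + by case/orP: tW => [->|/mW->]; rewrite ?orbT.
  + by case/orP: cW => [->|/mW->]; rewrite ?orbT.
- move=> m' W' sW' e; apply: hit; first exact: subseq_trans sW' (rem_subseq _ _).
  by move: e; rewrite size_rem //; case: (W) sW => //= w W0 _; lia.
Qed.

(** Induction on [W], whose first vertex [x] becomes a spectator.  The term
    [t = x] has all its vertices right of [x] or among the spectators, so the
    bounded hypothesis applies with [z := x].  The walks that visit [x] are
    again of the form [last_split], with weights [A x], unless they stop at [x]; in
    that case the sum is one of [walks] for the transposed matrix. *)
Lemma last_split_nonneg n : walks_nonneg n ->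
  forall A k m z y U W, (size U + size W <= n)%N -> (size U + size W = k + m.+2)%N ->
  uniq (z :: U ++ W) -> tp_on k.+1 A (z :: U ++ W) ->
  adm_row k.+1 A U W y -> {in W, forall s, 0 <= y s} ->
  0 <= last_split m A y z W U.
Proof.
move=> Gn A k m z y U W.
have [N sN] := ubnP (size W); elim: N => // N IH in A k m z y U W sN *.
move=> sn e uzW AW yW y0.
have [sW|sW] := leqP (size W) m.+1.
  rewrite /last_split big_seq big1 // => t tW; rewrite walks_short ?mulr0 //.
  by rewrite size_rem //; case: (W) sW tW.
case: W => [|x W] in sN sn e uzW AW yW y0 sW *; first by [].
have AxW : tp_on k.+1 A (U ++ x :: W) by apply: tp_on_sub AW; apply: subseq_cons.
have uUxW : uniq (U ++ x :: W) by case/andP: uzW.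
have uxW : uniq (x :: W) by move: uUxW; rewrite cat_uniq => /and3P[].
have xW : x \notin W by case/andP: uxW.
have AW0 : {in [:: z, x & U ++ W] &, forall s c, 0 <= A s c}.
  move=> s c sW' cW'; apply: (tp_on_entry AW); [move: sW'|move: cW'];
  by rewrite !inE !mem_cat !inE => /or4P[] ->; rewrite ?orbT.
rewrite /last_split big_cons /= eqxx.
have -> : \sum_(t <- W) A t z * walks m A A y t (if x == t then W else x :: rem t W) U
  = \sum_(t <- W) A t z * walks m A A y t (x :: rem t W) U.
  apply: eq_big_seq => t tW.
  by have /negbTE-> : x != t by apply: contraNneq xW => ->.
apply: addr_ge0.
  apply: mulr_ge0; first by apply: AW0; rewrite !inE eqxx ?orbT.
  apply: (Gn A k) => //.
  - by move: sn => /=; rewrite addnS.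
  - by move: e => /=; lia.
  - by apply: adm_row_sub yW; apply: subseq_cons.
  - by move=> s sW'; apply: y0; rewrite inE sW' orbT.
apply: le_trans (last_split_cons _ _ _ _ _); first last.
- move=> m' W' sW' e'.
  have mW' := mem_subseq sW'.
  have sub : subseq (z :: U ++ W') (z :: U ++ x :: W).
    by rewrite subseq_cons2 cat_subseq // subseqW.
  have subx : subseq (U ++ x :: W') (U ++ x :: W).
    by rewrite cat_subseq // subseq_cons2.
  case: m' e' => [|j] e'.
    have -> : \sum_(t <- W') A t z * walk 0 A A x t (rem t W') U
      = walks 0 (fun i j => A j i) (fun i j => A j i) (fun t => A t z) x W' U.
      by apply: eq_bigr => t _; rewrite /= slot_tr.
    apply: (Gn _ k) => //.
    + by move: sn e e' => /=; lia.
    + by move: sn e e' => /=; lia.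
    + exact: subseq_uniq subx uUxW.
    + by apply: tp_on_tr; apply: tp_on_sub subx _.
    + apply: (@adm_row_left _ _ _ _ [::] z U W').
      by apply: tp_on_tr; apply: tp_on_sub sub AW.
    + by move=> s /mW' sW1; apply: AW0; rewrite !inE ?mem_cat ?sW1 ?eqxx ?orbT.
  rewrite -/(last_split j A (A x) z W' U).
  apply: (IH A k) => //.
  + by apply: leq_ltn_trans (size_subseq sW') _.
  + by apply: leq_trans sn; rewrite leq_add2l (leq_trans (size_subseq sW')).
  + by move: e e' => /=; lia.
  + exact: subseq_uniq sub uzW.
  + exact: tp_on_sub sub AW.
  + rewrite -[U]cats0; apply: adm_row_left; exact: tp_on_sub subx AxW.
  + by move=> s /mW' sW1; apply: AW0; rewrite !inE ?mem_cat ?sW1 ?eqxx ?orbT.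
- move=> s c sW1 cW1; apply: AW0; [move: sW1|move: cW1];
  by rewrite !inE !mem_cat => /orP[]->; rewrite ?orbT.
- by move=> s sW1; apply: y0; rewrite inE sW1 orbT.
- by apply: y0; rewrite mem_head.
- by [].
apply: (IH A k) => //.
- by rewrite size_rcons; move: sn => /=; lia.
- by rewrite size_rcons; move: e => /=; lia.
- by rewrite cat_rcons.
- by rewrite cat_rcons.
- exact: adm_row_rcons.
- by move=> s sW1; apply: y0; rewrite inE sW1 orbT.
Qed.

Lemma walks_nonnegP n : walks_nonneg n.
Proof.
elim: n => // n IH A k b z y G X sn e uX AX yX y0.
have [sX|sX] := leqP (size X) b; first by rewrite walks_short.
case: G => [|g G] in sn e uX AX yX *.
  have [zX uX'] := andP uX.
  case: b => [|b] in sX e *.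
    by apply: walks0_nonneg AX yX => //; rewrite -[LHS]add0n e addn1.
  rewrite walks_last_split //; apply: (last_split_nonneg IH) yX y0 => //.
(* There are more than [b] vertices in [X], so a spectator forces [k > 0] and the
   minors of order 2 are available. *)
case: k => [|k] in e AX yX *; first by move: e sX => /=; lia.
have [gg0|gg] := eqVneq (A g g) 0.
  (* Row [g] or column [g] vanishes, hence all the determinants do. *)
  rewrite /walks big_seq big1 // => s sX'; rewrite walk_zero ?mulr0 //.
  pose N := G ++ z :: X.
  have Nmem c : c \in N = (c \in [:: z & G ++ X]).
    by rewrite !(inE, mem_cat) orbCA.
  have [||h c hN cN|r0|c0] := @zero_corner _ _ _ A g g N N gg0.
  - by move=> h hN; apply: (tp_on_entry AX); rewrite inE ?hN ?eqxx ?orbT.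
  - by move=> h hN; apply: (tp_on_entry AX); rewrite inE ?hN ?eqxx ?orbT.
  - by apply: (AX [:: g; h] [:: g; c]); rewrite // ?subseq_cons2 sub1seq.
  - left=> c; rewrite !inE mem_cat => /or4P[/eqP->|/eqP->//|cG|/mem_rem cX];
      by apply: r0; rewrite Nmem inE ?mem_cat ?eqxx ?cG ?cX ?orbT.
  - right=> c; rewrite !inE mem_cat => /or4P[/eqP->|/eqP->//|cG|/mem_rem cX];
      by apply: c0; rewrite Nmem inE ?mem_cat ?sX' ?cG ?cX ?orbT.
have ggp : 0 < A g g by rewrite lt0r gg (tp_on_entry AX) ?mem_head.
rewrite walks_schur //; apply: mulr_ge0; first exact: ltW.
have A1X : tp_on k.+1 (schur A g) (G ++ z :: X) by apply: tp_on_schur AX.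
have uX1 : uniq (G ++ z :: X) by case/andP: uX.
have g0 : {in X, forall s, 0 <= A g s}.
  by move=> s sX1; apply: (tp_on_entry AX); rewrite inE ?mem_cat ?inE ?eqxx ?sX1 ?orbT.
(* [A] is [schur A g] plus the product of its column [g], divided by the pivot,
   and its row [g]. *)
apply: le_trans (@walks_mono _ _ _ _ (schur A g) (fun s => A s g / A g g) (A g)
  _ _ _ _ _ _ _ _ _ _).
- apply: (IH _ k) => //; by move: sn e => /=; lia.
- by move=> s c; rewrite /schur /eliminate; ring.
- by move=> s c sX1 cX1; apply: (tp_on_entry A1X); rewrite mem_cat inE ?sX1 ?cX1 ?orbT.
- move=> s sX1; apply: divr_ge0; last exact: ltW.
  by apply: (tp_on_entry AX); rewrite inE ?mem_cat ?inE ?eqxx ?sX1 ?orbT.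
- exact: g0.
- move=> b' X' sX' e'.
  have sub : subseq (G ++ z :: X') (G ++ z :: X) by rewrite cat_subseq // subseq_cons2.
  have sub' : subseq (g :: G ++ X') (g :: G ++ z :: X).
    by rewrite subseq_cons2 cat_subseq // subseqW.
  apply: (IH _ k) => //.
  + by have := size_subseq sX'; move: sn => /=; lia.
  + by move: e e' => /=; lia.
  + exact: subseq_uniq sub uX1.
  + exact: tp_on_sub sub A1X.
  + have AX' := tp_on_sub sub' AX.
    apply: adm_row_of_top; first exact: tp_on_schur AX'.
    by apply: (top_row_leq (leqnSn _)); apply: top_row_head.
  + by move=> s /(mem_subseq sX'); apply: g0.
- exact: y0.
Qed.

End Positivity.

(** * Walks on both sides of the marked vertex *)

Section TwoSides.
Variables (F : realFieldType) (T : eqType).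
Implicit Types (A : T -> T -> F) (L R X Y : seq T).

Lemma rem_cat (s : T) X Y :
  rem s (X ++ Y) = if s \in X then rem s X ++ Y else X ++ rem s Y.
Proof.
elim: X => //= x X IH; rewrite inE eq_sym.
by have [//|_] := eqVneq s x; rewrite IH; case: ifP.
Qed.

(** [e] is the point at which a walk that has stayed in [L] crosses to [R]; [X] and
    [Y] are what is then left of the two sides. *)
Definition one_sided_nonneg k A v L R := forall e X Y b,
  e \in L -> e \notin X -> subseq X L -> subseq Y R ->
  (size X + size Y = k + b.+1)%N -> 0 <= walks b A A (A e) v Y X.

Lemma subseq_insert (e : T) X L : uniq L -> subseq X L -> e \in L -> e \notin X ->
  exists X1 X2, X = X1 ++ X2 /\ subseq (X1 ++ e :: X2) L.
Proof.
move=> uL /(subseq_uniqP uL) defX eL eX.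
case/splitPr: eL uL defX => L1 L2 uL ->.
exists [seq x <- L1 | x \in X], [seq x <- L2 | x \in X]; split.
  by rewrite filter_cat /= (negbTE eX).
by rewrite cat_subseq ?filter_subseq // subseq_cons2 filter_subseq.
Qed.

Lemma one_sided_left k A v L R : uniq (L ++ v :: R) -> tp_on k.+1 A (L ++ v :: R) ->
  one_sided_nonneg k A v L R.
Proof.
move=> uLR ALR e X Y b eL eX sX sY sXY.
have uL : uniq L by move: uLR; rewrite cat_uniq => /and3P[].
have [X1 [X2 [defX sX12]]] := subseq_insert uL sX eL eX.
have sXvY : subseq (X ++ v :: Y) (L ++ v :: R).
  by rewrite cat_subseq // subseq_cons2.
apply: (@walks_nonnegP _ _ (size X + size Y).+1 A k) => //.
- exact: subseq_uniq sXvY uLR.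
- exact: tp_on_sub sXvY ALR.
- rewrite defX; apply: adm_row_left; apply: tp_on_sub ALR.
  by rewrite -cat_cons catA cat_subseq // subseqW.
- move=> s /(mem_subseq sY) sR; apply: (tp_on_entry ALR).
    by rewrite mem_cat eL.
  by rewrite mem_cat inE sR !orbT.
Qed.

(** The order is reversed, which exchanges the sides and preserves total
    nonnegativity. *)
Lemma one_sided_right k A v L R : uniq (L ++ v :: R) -> tp_on k.+1 A (L ++ v :: R) ->
  one_sided_nonneg k A v R L.
Proof.
move=> uLR ALR e X Y b eR eX sX sY sXY.
have revE : rev (L ++ v :: R) = rev R ++ v :: rev L.
  by rewrite rev_cat rev_cons cat_rcons.
have := @one_sided_left k A v (rev R) (rev L).
rewrite -revE rev_uniq => /(_ uLR (tp_on_rev ALR)) /(_ e (rev X) (rev Y) b).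
rewrite !mem_rev !subseq_rev !size_rev => /(_ eR eX sX sY sXY).
by rewrite (@walks_perm _ _ _ _ _ _ _ _ Y _ X) // perm_rev.
Qed.

(** A first step into [Y] is followed, by induction with the sides exchanged, by at
    least the walks that stay in [Y]; all these together are nonnegative by
    [one_sided_nonneg]. *)
Lemma walk_split_sides k A v b L R e X Y :
    one_sided_nonneg k A v L R -> one_sided_nonneg k A v R L ->
    {in L ++ R &, forall x c, 0 <= A x c} -> uniq (X ++ Y) ->
    e \in L -> e \notin X -> subseq X L -> subseq Y R ->
    (size X + size Y = k + b)%N ->
  walk b A A e v X Y <= walk b A A e v (X ++ Y) [::].
Proof.
elim: b L R e X Y => [|b IH] L R e X Y LR RL A0 uXY eL eX sX sY sXY.
  by rewrite /= (slot_perm _ _ _ (permEl (perm_catC Y X))).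
have mX := mem_subseq sX; have mY := mem_subseq sY.
have [uX dXY uY] : [/\ uniq X, ~~ has (mem X) Y & uniq Y].
  by move: uXY; rewrite cat_uniq => /and3P.
rewrite /= big_cat /= -[leLHS]addr0; apply: lerD.
  rewrite !(big_seq _ _ X); apply: ler_sum => s sX1.
  apply: ler_wpM2l; first by apply: A0; rewrite mem_cat ?eL ?mX.
  rewrite rem_cat sX1; apply: (IH L R) => //.
  - by have := rem_uniq s uXY; rewrite rem_cat sX1.
  - exact: mX.
  - by rewrite mem_rem_uniqF.
  - exact: subseq_trans (rem_subseq _ _) sX.
  - by move: sXY; rewrite size_rem //; case: (X) sX1 => //= x X0 _; lia.
apply: (@le_trans _ _ (walks b A A (A e) v Y X)); first exact: (LR e).
rewrite /walks !(big_seq _ _ Y); apply: ler_sum => s sY1.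
apply: ler_wpM2l; first by apply: A0; rewrite mem_cat ?eL ?(mY _ sY1) ?orbT.
have sX1 : s \notin X by apply: contra dXY => sX1; apply/hasP; exists s.
rewrite rem_cat (negbTE sX1).
rewrite (@walk_perm _ _ _ _ _ _ _ (X ++ _) (rem s Y ++ X) _ [::]) //; last first.
  exact: permEl (perm_catC _ _).
apply: (IH R L) => //.
- by move=> x c; rewrite !mem_cat ![_ || (_ \in L)]orbC -!mem_cat; apply: A0.
- by have := rem_uniq s uXY; rewrite rem_cat (negbTE sX1) uniq_catC.
- exact: mY.
- by rewrite mem_rem_uniqF.
- exact: subseq_trans (rem_subseq _ _) sY.
- by move: sXY; rewrite size_rem //; case: (Y) sY1 => //= x X0 _; lia.
Qed.

Lemma walk_closed_nonneg k b A v L R :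
    (size L + size R = k + b)%N -> uniq (L ++ v :: R) ->
    tp_on k.+1 A (L ++ v :: R) ->
  0 <= walk b A A v v (L ++ R) [::].
Proof.
move=> sLR uLR ALR.
have LR := one_sided_left uLR ALR; have RL := one_sided_right uLR ALR.
have uvLR : uniq (v :: L ++ R) by rewrite -(perm_uniq (permEl (perm_catCA L [:: v] R))).
have /andP[_ uLR1] : (v \notin L ++ R) && uniq (L ++ R) by [].
have [uL dLR uR] : [/\ uniq L, ~~ has (mem L) R & uniq R].
  by move: uLR1; rewrite cat_uniq => /and3P.
have A0 : {in v :: L ++ R &, forall x c, 0 <= A x c}.
  move=> x c xL cL; apply: (tp_on_entry ALR);
  by rewrite (perm_mem (permEl (perm_catCA L [:: v] R))).
case: b => [|b] in sLR *.
  have -> : walk 0 A A v v (L ++ R) [::] = ldet (map A (L ++ v :: R)) (L ++ v :: R).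
    have := @ldet_perm F T T A id _ _ (permEl (perm_catCA L [:: v] R)).
    by rewrite !map_id => ->.
  by apply: ALR; rewrite ?subseq_refl // size_cat /= addnS sLR addn0.
have half L' R' : one_sided_nonneg k A v L' R' -> one_sided_nonneg k A v R' L' ->
    {in v :: L' ++ R' &, forall x c, 0 <= A x c} -> uniq (L' ++ R') ->
    (size L' + size R' = k + b.+1)%N ->
    walks b A A (A v) v L' R' <=
      \sum_(s <- L') A v s * walk b A A s v (rem s (L' ++ R')) [::].
  move=> LR1 RL1 A1 u1 s1.
  have uL1 : uniq L' by move: u1; rewrite cat_uniq => /andP[].
  rewrite /walks !(big_seq _ _ L'); apply: ler_sum => s sL.
  apply: ler_wpM2l; first by apply: A1; rewrite inE ?eqxx ?mem_cat ?sL ?orbT.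
  rewrite rem_cat sL; apply: (walk_split_sides LR1 RL1) => //.
  - by move=> x c xL cL; apply: A1; rewrite inE ?xL ?cL orbT.
  - by have := rem_uniq s u1; rewrite rem_cat sL.
  - by rewrite mem_rem_uniqF.
  - exact: rem_subseq.
  - by move: s1; rewrite size_rem //; case: (L') sL => //= x X0 _; lia.
have ad G X : uniq (G ++ v :: X) -> tp_on k.+1 A (G ++ v :: X) ->
    (size G + size X = k + b.+1)%N -> {in X, forall s, 0 <= A v s} ->
    0 <= walks b A A (A v) v X G.
  move=> uG AG sG A1; apply: (@walks_nonnegP _ _ (size G + size X).+1 A k) => //.
  by rewrite -[G]cats0; apply: adm_row_left.
rewrite walkS /walks big_cat /=; apply: addr_ge0.
  apply: le_trans (half _ _ LR RL A0 uLR1 sLR).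
  rewrite (@walks_perm _ _ _ _ _ _ _ _ (rev L) _ (rev R)) 1?perm_sym ?perm_rev //.
  have revE : rev (L ++ v :: R) = rev R ++ v :: rev L.
    by rewrite rev_cat rev_cons cat_rcons.
  apply: ad; rewrite -?revE ?rev_uniq ?size_rev 1?addnC //; first exact: tp_on_rev.
  by move=> s; rewrite mem_rev => sL; apply: A0; rewrite inE ?eqxx ?mem_cat ?sL ?orbT.
under eq_big_seq => s sR.
  rewrite (@walk_perm _ _ b A A s v _ (rem s (R ++ L)) _ [::]) //; last first.
    by apply: perm_rem; rewrite perm_catC.
  over.
apply: le_trans (half _ _ RL LR _ _ _) => //; first last.
- by rewrite addnC.
- by rewrite uniq_catC.
- move=> x c xR cR; apply: A0; move: xR cR; rewrite !inE !mem_cat;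
  by rewrite ![(_ \in R) || _]orbC.
by apply: ad => // s sR; apply: A0; rewrite inE ?eqxx ?mem_cat ?sR ?orbT.
Qed.
End TwoSides.

(** * Contraction of the marked cycle *)

Section Permutations.
Variables (F : realFieldType) (V : finType) (A : V -> V -> F).
Implicit Types (v e t : V) (X : seq V) (s u : {perm V}).

Lemma porbit_subset s v (B : {set V}) :
  v \in B -> (forall x, x \in B -> s x \in B) -> porbit s v \subset B.
Proof.
move=> vB sB; apply/subsetP => x /porbitP[i ->].
elim: i => [|i IH]; first by rewrite expg0 perm1.
by rewrite expgSr permM sB.
Qed.

Lemma porbit_stable s v x : (s x \in porbit s v) = (x \in porbit s v).
Proof. by rewrite -!eq_porbit_mem -(porbit_perm s 1 x) expg1. Qed.

(** [t] is inserted between [v] and the image of [v] in the cycle of [v]. *)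
Lemma card_porbit_mul_tperm u v t : t != v -> u t = t ->
  #|porbit (tperm v t * u)%g v| = #|porbit u v|.+1.
Proof.
move=> tv ut; set s := (tperm v t * u)%g.
have sv : s v = t by rewrite permM tpermL.
have st : s t = u v by rewrite permM tpermR.
have sx x : x != v -> x != t -> s x = u x.
  by move=> xv xt; rewrite permM tpermD // eq_sym.
have tu : t \notin porbit u v.
  have /subsetP sub : porbit u v \subset [set~ t].
    apply: porbit_subset => [|x]; first by rewrite !inE eq_sym.
    by rewrite !inE; apply: contra => /eqP e; rewrite -(inj_eq (@perm_inj _ u)) ut e.
  by apply/negP => /sub; rewrite !inE eqxx.
have uvx x : x \in porbit u v -> u x \in porbit u v by rewrite porbit_stable.
have svx x : x \in porbit s v -> s x \in porbit s v by rewrite porbit_stable.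
suff -> : porbit s v = t |: porbit u v by rewrite cardsU1 tu.
apply/eqP; rewrite eqEsubset; apply/andP; split.
  apply: porbit_subset => [|x]; first by rewrite !inE porbit_id orbT.
  rewrite !inE => /orP[/eqP->|xu]; first by rewrite st uvx ?porbit_id ?orbT.
  have [->|xv] := eqVneq x v; first by rewrite sv eqxx.
  rewrite sx ?uvx ?orbT //; apply: contraNneq tu => <-; exact: xu.
have sub : t \in porbit s v by rewrite -sv svx // porbit_id.
rewrite subUset sub1set sub; apply: porbit_subset => [|x xs]; first exact: porbit_id.
have [->|xt] := eqVneq x t; first by rewrite ut.
have [->|xv] := eqVneq x v; first by rewrite -st svx.
by rewrite -sx ?svx.
Qed.

Lemma card_porbit1 s v : (1 < #|porbit s v|)%N = (s v != v).
Proof.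
apply/idP/idP.
  apply: contraTneq => sv; rewrite -leqNgt -(cards1 v) subset_leq_card //.
  by apply: porbit_subset => [|x]; rewrite !inE // => /eqP->; rewrite sv.
move=> sv; have sub : [set v; s v] \subset porbit s v.
  by rewrite subUset !sub1set porbit_id -(expg1 s) mem_porbit.
by apply: leq_trans (subset_leq_card sub); rewrite cards2 eq_sym sv.
Qed.

(** The row of [v] is replaced by the row of [e]: after contracting the step from
    [v] to [s], the row of [s] takes the place of that of [v]. *)
Definition marked_sum b v e X : F :=
  \sum_(s : {perm V} | perm_on [set x in v :: X] s && (b < #|porbit s v|)%N)
    (-1) ^+ s * (A e (s v) * \prod_(i <- X) A i (s i)).

(** A cycle of length at least 2 moves [v] to some [t], and composing with the
    transposition of [v] and [t] is a bijection onto the permutations that fix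
    [t]. *)
Lemma marked_sumS b v e X : uniq (v :: X) ->
  marked_sum b.+1 v e X = - \sum_(t <- X) A e t * marked_sum b v t (rem t X).
Proof.
move=> uvX; have [vX uX] : v \notin X /\ uniq X by apply/andP.
rewrite /marked_sum.
rewrite (partition_big (fun s : {perm V} => s v) (fun t => t \in X)) /=; last first.
  move=> s /andP[sX sb]; have := perm_closed v sX; rewrite !inE eqxx /=.
  have : s v != v by rewrite -card_porbit1; apply: leq_ltn_trans sb.
  by move=> /negbTE ->.
rewrite -sumrN (big_uniq _ uX) /=; apply: eq_bigr => t tX.
have tv : t != v by apply: contraNneq vX => <-.
rewrite (reindex_inj (mulgI (tperm v t))) /= -mulrN -sumrN mulr_sumr.
apply: eq_big => [u|u].
  rewrite permM tpermL.
  have -> : perm_on [set x in v :: X] (tperm v t * u)%g = perm_on [set x in v :: X] u.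
    have tX' : perm_on [set x in v :: X] (tperm v t).
      apply: subset_trans (tperm_on v t) _; apply/subsetP => x.
      by rewrite !inE => /orP[]/eqP->; rewrite ?eqxx ?tX ?orbT.
    apply/idP/idP; last exact: perm_onM.
    by move/(perm_onM tX'); rewrite mulgA tperm2 mul1g.
  have -> : perm_on [set x in v :: rem t X] u
      = perm_on [set x in v :: X] u && (u t == t).
    apply/subsetP/andP => [sub|[/subsetP sub /eqP ut] x ux].
      split; first apply/subsetP => x /sub.
        by rewrite !inE mem_rem_uniq // !inE => /orP[->//|/andP[_ ->]]; rewrite orbT.
      apply: contraT => ut; have := sub t ut.
      by rewrite !inE mem_rem_uniq // !inE eqxx (negbTE tv).
    have := sub x ux; rewrite !inE mem_rem_uniq // !inE => /orP[->//|->].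
    by rewrite andbT; apply/orP; right; apply: contraTneq ux => ->; rewrite inE ut eqxx.
  have [ut|_] := eqVneq (u t) t; last by rewrite !andbF.
  by rewrite !andbT card_porbit_mul_tperm.
rewrite permM tpermL => /andP[_ /eqP ut].
rewrite odd_permM odd_tperm eq_sym tv ut signr_addb expr1 mulN1r.
rewrite (perm_big _ (perm_to_rem tX)) /= big_cons permM tpermR.
have -> : \prod_(j <- rem t X) A j ((tperm v t * u)%g j)
    = \prod_(j <- rem t X) A j (u j).
  apply: eq_big_seq => j; rewrite mem_rem_uniq // !inE => /andP[jt jX].
  by rewrite permM tpermD // eq_sym //; apply: contraNneq vX => <-.
by rewrite mulrN mulNr; congr (- _); rewrite mulrCA.
Qed.

(** Both sides satisfy the same recursion, according to the image of [v]:
    [marked_sumS] on the left, [ldet_laplace] on the right. *)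
Lemma marked_sum0 v e X : uniq (v :: X) -> marked_sum 0 v e X = slot A e v X.
Proof.
have [n] := ubnP (size X); elim: n => // n IH in v e X *.
rewrite ltnS => sX uvX; have [vX uX] : v \notin X /\ uniq X by apply/andP.
rewrite /slot ldet_laplace //.
rewrite /marked_sum (bigID (fun s : {perm V} => s v == v)) /=; congr (_ + _).
  have E : \sum_(s | perm_on [set x in X] s) (-1) ^+ s * \prod_(i <- X) A i (s i)
     = ldet (map A X) X.
    case: X sX uvX vX uX => [|x X] sX uvX vX uX.
      rewrite ldet_nil (big_pred1 1%g) => [|s].
        by rewrite odd_perm1 expr0 mul1r big_nil.
      apply/idP/eqP => [/subsetP s0|->]; last exact: perm_on1.
      apply/permP => x; rewrite perm1; apply/eqP; apply: contraT => sx.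
      by have := s0 x; rewrite !inE => /(_ sx).
    rewrite -[RHS](IH x x X) //; apply: eq_big => s; last by rewrite big_cons.
    have -> : (0 < #|porbit s x|)%N by apply/card_gt0P; exists x; apply: porbit_id.
    by rewrite andbT.
  rewrite -E mulr_sumr; apply: eq_big => s.
    have -> : (0 < #|porbit s v|)%N by apply/card_gt0P; exists v; apply: porbit_id.
    rewrite andbT; apply/andP/subsetP => [[/subsetP sub /eqP sv] x xs|sub].
      by have := sub x xs; rewrite !inE => /predU1P[xv|//]; rewrite inE xv sv eqxx in xs.
    split; first by apply/subsetP => x /sub; rewrite !inE => ->; rewrite orbT.
    by apply: contraT => sv; have := sub v sv; rewrite inE (negbTE vX).
  by case/andP => _ /eqP->; rewrite mulrCA.
transitivity (marked_sum 1 v e X).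
  apply: eq_bigl => s; rewrite card_porbit1 -andbA; congr (_ && _).
  by rewrite andb_idl // => _; apply/card_gt0P; exists v; apply: porbit_id.
rewrite marked_sumS //; congr (- _); apply: eq_big_seq => t tX; congr (_ * _).
apply: IH; first by rewrite size_rem //; case: (X) tX sX.
by rewrite /= rem_uniq // andbT; apply: contra vX; apply: mem_rem.
Qed.

Lemma marked_sum_walk b v e X : uniq (v :: X) ->
  (-1) ^+ b * marked_sum b v e X = walk b A A e v X [::].
Proof.
elim: b e X => [|b IH] e X uvX; first by rewrite expr0 mul1r marked_sum0.
have [vX uX] : v \notin X /\ uniq X by apply/andP.
rewrite marked_sumS // exprS mulN1r mulrNN mulr_sumr /=.
apply: eq_big_seq => t tX; rewrite mulrCA IH //.
by rewrite /= rem_uniq // andbT; apply: contra vX; apply: mem_rem.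
Qed.

Lemma cycle_sum_walk a v X : (0 < a)%N -> perm_eq (enum V) (v :: X) ->
  cycle_sum a A v = walk a.-1 A A v v X [::].
Proof.
case: a => // a _ pX.
have uvX : uniq (v :: X) by rewrite -(perm_uniq pX) enum_uniq.
rewrite -marked_sum_walk // /cycle_sum /cycle_length; congr (_ * _).
apply: eq_big => [s|s _].
  rewrite andb_idl // => _; apply/subsetP => x _.
  by rewrite inE -(perm_mem pX) mem_enum.
congr (_ * _); transitivity (\prod_(i <- enum V) A i (s i)).
  by rewrite /wt big_enum.
by rewrite (perm_big _ pX) big_cons.
Qed.

End Permutations.

(** * From minors to lists *)

Lemma sorted_enum_set (d : Order.disp_t) (V : finOrderType d) (R : seq V) :
  subseq R (Order.enum V) -> Order.enum [set x in R] = R.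
Proof.
move=> sR; have uR : uniq R by apply: subseq_uniq sR (Order.enum_uniq _).
apply: (sorted_eq le_trans le_anti).
- exact: sort_sorted le_total _.
- apply: (subseq_sorted le_trans sR); exact: sort_sorted le_total _.
apply: uniq_perm => // [|x]; first exact: Order.enum_uniq.
by rewrite Order.mem_enum inE.
Qed.

Lemma tp_on_enum (R : realType) (d : Order.disp_t) (V : finOrderType d) r
  (A : V -> V -> R) : TP r A -> tp_on r A (Order.enum V).
Proof.
move=> hA I J sI sJ sIJ rI.
have eI := sorted_enum_set sI; have eJ := sorted_enum_set sJ.
have cI : #|[set x in I]| = size I by rewrite Order.cardE eI.
have cJ : #|[set x in J]| = size J by rewrite Order.cardE eJ.
have eIJ : #|[set x in J]| = #|[set x in I]| by rewrite cI cJ.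
suff -> : ldet (map A I) J = minor A eIJ by apply: hA; rewrite cI.
rewrite /minor (@ldet_dim _ _ #|[set x in I]|) ?size_map //.
congr (\det _); apply/matrixP => i j; rewrite castmxE !mxE.
have iI : (i < size I)%N by rewrite -cI.
have jJ : (j < size J)%N by rewrite -sIJ -cI.
have x0 := Order.enum_val i.
rewrite !(Order.enum_val_nth x0) eI eJ.
by rewrite (nth_map x0) // (nth_map x0).
Qed.

Theorem mainTheorem2 (R : realType) (a k : nat) (ha : (1 <= a)%N)
    (d : Order.disp_t) (V : finOrderType d) (hV : #|V| = (a + k)%N)
    (A : V -> V -> R) (hA : TP k.+1 A) (v : V) :
  0 <= cycle_sum a A v.
Proof.
have AV := tp_on_enum hA; have uV := Order.enum_uniq V.
have vV : v \in Order.enum V by rewrite Order.mem_enum.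
have pV : perm_eq (enum V) (Order.enum V) by rewrite perm_sym perm_sort.
have sV := perm_size pV; rewrite -cardE hV in sV.
case/splitPr: vV AV uV pV sV => L0 R0 AV uV pV sV.
rewrite (@cycle_sum_walk _ _ _ _ _ (L0 ++ R0)) //.
  apply: (walk_closed_nonneg (k := k)) => //.
  by move: sV; rewrite size_cat /=; lia.
by rewrite (perm_trans pV) // (permEl (perm_catCA L0 [:: v] R0)).
Qed.
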